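(* Let $G$ be a finitely generated group. If $G$ is $\mathbb{Z}$-large, then there exists $N$ such that the product replacement graph $\Gamma_n(G)$ is non-amenable for every $n\geq N$.
   Context: Graphs: a graph $\Gamma=(V,E)$ is a possibly infinite undirected graph of bounded degree, possibly with loops and repeated edges (edges are counted with multiplicity); it need not be connected. Cheeger constant: for a nonempty graph $\Gamma$, $h(\Gamma)=\inf_X |\partial X|/|X|$, where $X$ runs over all nonempty finite sets of vertices and $\partial X$ is the set of edges between $X$ and its complement. $\Gamma$ is non-amenable if $h(\Gamma)>0$ (connectedness is not required). Product replacement graph: $\Gamma_n(G)$ is the graph whose vertices are the $n$-tuples $(s_1,\dots,s_n)\in G^n$ with $G=\langle s_1,\dots,s_n\rangle$, with edges, for each pair $1\le i,j\le n$, $i\neq j$, and each sign, joining $(s_1,\dots,s_n)$ to the tuple obtained by replacing $s_j$ with $s_j s_i^{\pm1}$ and to the tuple obtained by replacing $s_j$ with $s_i^{\pm 1}s_j$ (all other entries unchanged). A group $G$ is $\mathbb{Z}$-large if it has a finite index subgroup which has $\mathbb{Z}$ as a quotient. *)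

(* Defs.v *)
From HB Require Import structures.
From mathcomp Require Import all_boot all_order all_algebra finmap.
From mathcomp Require Import boolp classical_sets functions cardinality reals.

Set Implicit Arguments.
Unset Strict Implicit.
Unset Printing Implicit Defensive.

Import Order.TTheory GRing.Theory Num.Theory.

Local Open Scope classical_set_scope.
Local Open Scope card_scope.

(* Undirected multigraphs in the sense of Serre: an undirected edge is a pair
   {e, rev e} of opposite darts; loops and parallel edges are allowed. *)
Record multigraph := Multigraph {
  vertex : choiceType;
  dart : choiceType;
  src : dart -> vertex;
  tgt : dart -> vertex;
  rev : dart -> dart;
  revK : involutive rev;
  rev_neq : forall e, rev e != e;
  src_rev : forall e, src (rev e) = tgt e;
  bounded_degree : exists d, forall v, [set e | src e = v] #<= `I_d
}.

(* Exactly one of the two darts of an edge between X and its complement goes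
   from X to the complement, so these darts count the edges with multiplicity. *)
Definition boundary (Gamma : multigraph) (X : {fset vertex Gamma}) :
    set (dart Gamma) :=
  [set e | src e \in X /\ tgt e \notin X].

Lemma finite_boundary (Gamma : multigraph) (X : {fset vertex Gamma}) :
  finite_set (boundary X).
Proof.
have [d dP] := bounded_degree Gamma.
apply: (@sub_finite_set _ _ (\bigcup_(v in [set` X]) [set e | src e = v])).
  by move=> e [eX _]; exists (src e).
apply: bigcup_finite; first exact: finite_fset.
by move=> v _; apply: card_le_finite (dP v) (finite_II d).
Qed.

(* The infimum of the empty set is 0 in the library, so the empty graph, whose
   Cheeger constant is usually left undefined, is not non-amenable. *)
Definition cheeger (R : realType) (Gamma : multigraph) : R :=
  inf [set r : R | exists2 X : {fset vertex Gamma}, X != fset0 &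
         r = (#|` fset_set (boundary X)|%:R / #|` X|%:R)%R].

Definition non_amenable (R : realType) (Gamma : multigraph) : Prop :=
  (0 < cheeger R Gamma)%R.

Section Groups.
Variable G : groupType.

Definition subgroup (H : set G) : Prop := group_closed [in H].

Definition generated (A : set G) : set G := smallest subgroup A.

Definition finitely_generated : Prop :=
  exists2 A : set G, finite_set A & generated A = [set: G].

Definition left_coset (H : set G) (x : G) : set G :=
  [set (x * h)%g | h in H].

Definition finite_index (H : set G) : Prop :=
  finite_set [set left_coset H x | x in [set: G]].

(* H has Z as a quotient; only the values of f on H matter. *)
Definition has_Z_quotient (H : set G) : Prop :=
  exists2 f : G -> int,
    {in H &, forall x y, f (x * y)%g = (f x + f y)%R} &
    set_surj H [set: int] f.

Definition Z_large : Prop :=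
  exists H : set G, [/\ subgroup H, finite_index H & has_Z_quotient H].

Lemma subgroup_generated (A : set G) : subgroup (generated A).
Proof.
split; first by rewrite inE => H [/= -[H1 _] _]; rewrite inE in H1.
move=> x y; rewrite !inE => xA yA H /[dup] -[/= [_ HV] _] HA.
by have := HV x y; rewrite !inE; apply; [apply: xA|apply: yA].
Qed.

Section ProductReplacement.
Variable n : nat.

Definition generating_tuple : set {ffun 'I_n -> G} :=
  [set s : {ffun 'I_n -> G} | generated (range s) = [set: G]].

(* ((i, j), inverse, onleft): the entry s_j is multiplied by s_i, or by its
   inverse if the first flag is set; on the right, or on the left if the second
   flag is set. *)
Definition move : Type :=
  {p : 'I_n * 'I_n | p.1 != p.2} * bool * bool.

Definition move_inv (m : move) : move :=
  let: (p, inverse, onleft) := m in (p, ~~ inverse, onleft).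

Definition apply_move (m : move) (s : {ffun 'I_n -> G}) : {ffun 'I_n -> G} :=
  let: (p, inverse, onleft) := m in
  let: (i, j) := val p in
  let a := if inverse then ((s i)^-1)%g else s i in
  [ffun k => if k == j then (if onleft then a * s j else s j * a)%g else s k].

Lemma apply_moveK (m : move) : cancel (apply_move m) (apply_move (move_inv m)).
Proof.
move: m => [[[[i j] /= nij] inverse] onleft] s; apply/ffunP => k.
rewrite !ffunE (negbTE nij) eqxx; case: eqP => [->|//].
by case: inverse; case: onleft => /=;
  rewrite ?mulgK ?mulKg ?mulgVK ?mulVKg.
Qed.

Lemma move_invK : involutive move_inv.
Proof. by move=> [[p inverse] onleft] /=; rewrite negbK. Qed.

Lemma sub_generated_move (m : move) (s : {ffun 'I_n -> G}) :
  range (apply_move m s) `<=` generated (range s).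
Proof.
have [s1 sV] := subgroup_generated (range s).
have gpV := group_closedV (conj s1 sV); have gpM := group_closedM (conj s1 sV).
have sP k : s k \in [in generated (range s)].
  by rewrite inE; apply: sub_gen_smallest; exists k.
move: m => [[[[i j] /= nij] inverse] onleft] _ [k _ <-].
suff: (apply_move (exist _ (i, j) nij, inverse, onleft) s k
  \in [in generated (range s)]) by rewrite inE.
rewrite /= ffunE; case: eqP => // _.
by case: onleft; case: inverse; apply: gpM; rewrite ?sP // gpV ?sP.
Qed.

Lemma generating_move (m : move) (s : {ffun 'I_n -> G}) :
  s \in generating_tuple -> apply_move m s \in generating_tuple.
Proof.
rewrite !inE /generating_tuple /= => sG; apply/seteqP; split=> // x _.
have : generated (range s) x by rewrite sG.
apply: smallest_sub; first exact: subgroup_generated.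
by rewrite -{1}(apply_moveK m s); apply: sub_generated_move.
Qed.

Definition vertex_move (m : move) (s : generating_tuple) : generating_tuple :=
  Sub (apply_move m (val s)) (generating_move m (valP s)).

Definition prg_src (e : generating_tuple * move) : generating_tuple := e.1.

Definition prg_tgt (e : generating_tuple * move) : generating_tuple :=
  vertex_move e.2 e.1.

Definition prg_rev (e : generating_tuple * move) : generating_tuple * move :=
  (vertex_move e.2 e.1, move_inv e.2).

Lemma prg_revK : involutive prg_rev.
Proof.
move=> [s m]; rewrite /prg_rev /= move_invK; congr pair.
by apply: val_inj; rewrite /= apply_moveK.
Qed.

Lemma prg_rev_neq (e : generating_tuple * move) : prg_rev e != e.
Proof.
move: e => [s [[p inverse] onleft]]; apply/eqP => -[_].
by case: inverse.
Qed.

Lemma prg_src_rev (e : generating_tuple * move) :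
  prg_src (prg_rev e) = prg_tgt e.
Proof. by []. Qed.

Lemma prg_bounded_degree :
  exists d, forall v, [set e | prg_src e = v] #<= `I_d.
Proof.
have /finite_setP[d] := @finite_finset move [set: move].
rewrite card_eq_le => /andP[dP _]; exists d => v.
apply: (card_le_trans _ dP).
apply: (@card_le_trans _ _ _ [set (v, m) | m in [set: move]]).
  by apply: subset_card_le => -[w m] /= <-; exists m.
exact: card_image_le.
Qed.

Definition product_replacement_graph : multigraph :=
  @Multigraph generating_tuple (generating_tuple * move)%type
    prg_src prg_tgt prg_rev prg_revK prg_rev_neq prg_src_rev
    prg_bounded_degree.

End ProductReplacement.
End Groups.

(* Main.v *)
Require Import Defs.
From mathcomp Require Import all_boot all_order all_algebra finmap zify.
From mathcomp Require Import boolp classical_sets functions cardinality reals.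

Set Implicit Arguments.
Unset Strict Implicit.
Unset Printing Implicit Defensive.

Import Order.TTheory GRing.Theory Num.Theory.

(** The proof exhibits a Gromov-type paradox in Gamma_n(G).

    Suppose that the vertices fall into finitely many pieces and that on each
    piece there are more bounded words of moves than there are pieces, with
    pairwise disjoint images of that piece.  A finite set X with a very small
    boundary is almost invariant under bounded words, so each piece would
    occupy less than its share of X, and the pieces could not cover X.
    [paradoxical_bound] is the quantitative form, with an explicit
    isoperimetric constant.

    The paradox comes from the shears of SL_2(Z).  Let H have finite index and
    let f map H onto Z.  If s_i and s_j lie in H, with x = f(s_i) nonzero and
    y = f(s_j) at most |x| in absolute value, then replacing s_j by
    s_j s_i^(3r) turns (x, y) into (x, y + 3rx), and the new pair determines r
    ([shear_recover]).  So the tuples for which a given word of moves and given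
    indices i, j lead to this situation form a piece of the required kind; the
    number of shears r can be taken as large as one likes.

    It remains to see that finitely many such pieces suffice, i.e. that a
    bounded number of moves brings every generating tuple into the situation
    above ([near_shear_pair]).  Each s_i permutes the finite set of left cosets
    of H.  When n is large, two indices j1, j2 have the same permutation as two
    other entries, and dividing by these makes s_j1 and s_j2 act trivially on
    the cosets; in particular both lie in H.  Then the remaining entries still
    act transitively on the cosets, so there is a transversal of bounded words
    in them, which avoids s_j1.  The Schreier generators attached to it
    generate H, hence f does not vanish on all of them.  If f(s_j1) = 0, then
    multiplying s_j1 by a Schreier generator, or conjugating s_j1 by an element
    of the transversal, makes f(s_j1) nonzero ([near_nonzero]).
    Finally the two indices are ordered by the absolute values of f. *)

(** * Paradoxical decompositions bound the isoperimetric constant *)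

Section Expansion.
Variables (V : eqType) (M : Type) (mv : M -> V -> V).
Hypothesis mv_inj : forall m, injective (mv m).

Definition run (w : seq M) (v : V) : V := foldl (fun x m => mv m x) v w.

Lemma run_cat w1 w2 v : run (w1 ++ w2) v = run w2 (run w1 v).
Proof. exact: foldl_cat. Qed.

Lemma run_inj w : injective (run w).
Proof. by elim: w => [|m w IH] x y //= /IH /mv_inj. Qed.

(** A point carried out of X by a word is carried out by one of its letters;
    injectivity of the moves keeps the losses at each letter below [b]. *)
Lemma leak_run (X : seq V) b : uniq X ->
  (forall m, count [pred v | mv m v \notin X] X <= b) ->
  forall w, count [pred v | run w v \notin X] X <= size w * b.
Proof.
move=> uX leak; elim=> [|m w IH] /=.
  by rewrite (eq_in_count (a2 := pred0)) ?count_pred0 // => v /= ->.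
pose Y := [seq v <- X | (mv m v \in X) && (run w (mv m v) \notin X)].
have sY : size Y <= size w * b.
  apply: leq_trans IH; rewrite -size_filter -(size_map (mv m) Y).
  apply: uniq_leq_size; first by rewrite map_inj_uniq ?filter_uniq //.
  move=> _ /mapP[v + ->]; rewrite !mem_filter /= => /andP[/andP[mX wX] _].
  by rewrite wX.
rewrite mulSn; apply: leq_trans (leq_add (leak m) sY).
rewrite size_filter -count_predUI; apply: leq_trans (leq_addr _ _).
by apply: sub_count => v /= vX; case: (mv m v \in X).
Qed.

(** For one piece, the images under the [K] words are disjoint, so apart from
    the points that leak out of [X] they take [K] times the size of the piece
    inside [X].  Summing over the pieces gives [K * size X] on the left and only
    [#|P| * size X] plus the leaks on the right. *)
Lemma paradoxical_bound (P : finType) K L (a : V -> P)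
    (W : 'I_K -> P -> seq M) :
  #|P| < K -> (forall j p, size (W j p) <= L) ->
  (forall v v' j j', a v = a v' ->
     run (W j (a v)) v = run (W j' (a v')) v' -> j = j') ->
  forall (X : seq V) b, uniq X ->
  (forall m, count [pred v | mv m v \notin X] X <= b) ->
  size X <= #|P| * (K * L) * b.
Proof.
move=> PK WL Wdisj X b uX leak.
have piece p : K * count [pred v | a v == p] X <= size X + K * L * b.
  pose F (jv : 'I_K * V) := run (W jv.1 p) jv.2.
  pose S := [seq (j, v) | j <- enum 'I_K, v <- [seq v <- X | a v == p]].
  have -> : K * count [pred v | a v == p] X = size S.
    by rewrite size_allpairs size_enum_ord size_filter.
  rewrite -(count_predC [pred jv | F jv \in X]); apply: leq_add.
    rewrite -size_filter -(size_map F); apply: uniq_leq_size.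
      rewrite map_inj_in_uniq ?filter_uniq ?allpairs_uniq ?enum_uniq //.
      - by rewrite filter_uniq.
      - by move=> [? ?] [? ?].
      move=> jv jv'; rewrite !mem_filter /=.
      case/andP=> _ /allpairsP[[j v] /= [_ + ->]].
      rewrite mem_filter => /andP[/eqP av _].
      case/andP=> _ /allpairsP[[j' v'] /= [_ + ->]].
      rewrite mem_filter => /andP[/eqP av' _].
      rewrite /F /= => e.
      have jj : j = j' by apply: (Wdisj v v'); rewrite av av'.
      by move: e; rewrite jj => /run_inj ->.
    by move=> _ /mapP[jv + ->]; rewrite mem_filter => /andP[].
  (* The pairs whose image falls outside X are counted word by word. *)
  rewrite -sum1_count big_mkcond big_allpairs big_enum /= -mulnA.
  rewrite -[X in X * (L * b)]card_ord -sum_nat_const; apply: leq_sum => j _.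
  rewrite -big_mkcond sum1_count count_filter.
  apply: leq_trans (leq_mul (WL j p) (leqnn b)).
  apply: leq_trans (leak_run uX leak (W j p)).
  by apply: sub_count => v /= /andP[].
(* The pieces partition X, so the bounds for the pieces add up. *)
have : K * size X <= #|P| * (size X + K * L * b).
  have sX : size X = \sum_p count [pred v | a v == p] X.
    under eq_bigr do rewrite -sum1_count big_mkcond.
    rewrite exchange_big /= -sum1_size; apply: eq_bigr => v _.
    by rewrite -big_mkcond (big_pred1 (a v)) //= => p; rewrite eq_sym.
  rewrite {1}sX big_distrr /= -sum_nat_const.
  by apply: leq_sum => p _; exact: piece.
nia.
Qed.

End Expansion.

Lemma non_amenable_isoperimetric (R : realType) (Gamma : multigraph) C :
  inhabited (vertex Gamma) ->
  (forall X : {fset vertex Gamma}, #|` X| <= C * #|` fset_set (boundary X)|) ->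
  non_amenable R Gamma.
Proof.
move=> [v0] iso; apply: (@lt_le_trans _ _ (C.+1%:R^-1)%R).
  by rewrite invr_gt0 ltr0Sn.
apply: lb_le_inf.
  by eexists; exists [fset v0]%fset => //; rewrite -cardfs_gt0 cardfs1.
move=> _ [X X0 ->]; have X1 : 0 < #|` X| by rewrite cardfs_gt0.
rewrite ler_pdivlMr ?ltr0n // mulrC ler_pdivrMr ?ltr0Sn // -natrM ler_nat.
by rewrite mulnC; apply: leq_trans (iso X) _; rewrite leq_mul.
Qed.

Lemma leak_boundary (G : groupType) n (m : move n)
    (X : {fset vertex (product_replacement_graph G n)}) :
  count [pred v | vertex_move m v \notin enum_fset X] (enum_fset X)
    <= #|` fset_set (boundary X)|.
Proof.
rewrite -size_filter -(size_map (fun v => (v, m))).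
apply: uniq_leq_size.
  by rewrite map_inj_uniq ?filter_uniq ?fset_uniq // => v v' [].
move=> _ /mapP[v + ->]; rewrite mem_filter => /andP[/= mX vX].
rewrite (in_fset_set (finite_boundary X)).
by rewrite inE.
Qed.

(** * Words of moves acting on tuples *)

Section Words.
Variables (G : groupType) (n : nat).
Implicit Types (s t : {ffun 'I_n -> G}) (i j : 'I_n) (g x : G).
Local Open Scope group_scope.

Definition upd s j g : {ffun 'I_n -> G} :=
  [ffun i => if i == j then g else s i].

Lemma upd_eq s j g : upd s j g j = g.
Proof. by rewrite /upd ffunE eqxx. Qed.

Lemma upd_neq s j g i : i != j -> upd s j g i = s i.
Proof. by move=> /negbTE ij; rewrite ffunE ij. Qed.

Lemma upd_id s j : upd s j (s j) = s.
Proof. by apply/ffunP => i; rewrite ffunE; case: eqP => [->|]. Qed.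

Definition letter g (b : bool) : G := if b then g^-1 else g.

Lemma apply_move_upd i j (nij : i != j) b l s x :
  apply_move (exist _ (i, j) nij, b, l) (upd s j x) =
  upd s j (if l then letter (s i) b * x else x * letter (s i) b).
Proof.
by apply/ffunP => k; rewrite /= !ffunE eqxx (negbTE nij); case: eqP.
Qed.

Lemma run_cons_upd i j (nij : i != j) b l w s x :
  run (@apply_move G n) ((exist _ (i, j) nij, b, l) :: w) (upd s j x) =
  run (@apply_move G n) w
    (upd s j (if l then letter (s i) b * x else x * letter (s i) b)).
Proof. by rewrite -(apply_move_upd nij). Qed.

(** Moves are applied to arbitrary tuples here: intermediate tuples then need
    no proof of being generating, and [near_generating] recovers it. *)
Definition near L s t : Prop :=
  exists2 w : seq (move n), size w <= L & run (@apply_move G n) w s = t.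

Lemma near_trans L L' s t r : near L s t -> near L' t r -> near (L + L') s r.
Proof.
move=> [w sw <-] [w' sw' <-]; exists (w ++ w'); last by rewrite run_cat.
by rewrite size_cat leq_add.
Qed.

Lemma near_leq L L' s t : L <= L' -> near L s t -> near L' s t.
Proof. by move=> LL' [w sw wst]; exists w => //; apply: leq_trans LL'. Qed.

Lemma near_generating L s t :
  near L s t -> s \in @generating_tuple G n -> t \in @generating_tuple G n.
Proof.
move=> [w _ <-]; elim: w s => //= m w IH s sG.
by apply: IH; exact: generating_move.
Qed.

(** The index [j] is excluded so that multiplying the [j]-th entry by the word,
    one letter at a time, leaves the letters themselves unchanged. *)
Inductive word s j : nat -> G -> Prop :=
| word_nil : word s j 0 1
| word_cons i b m g :
    i != j -> word s j m g -> word s j m.+1 (letter (s i) b * g).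

Lemma word_mul s j m g m' g' :
  word s j m g -> word s j m' g' -> word s j (m + m') (g * g').
Proof.
elim=> [|i b {}m {}g ij _ IH] g'w; first by rewrite mul1g.
by rewrite -mulgA addSn; constructor=> //; apply: IH.
Qed.

Lemma word_letter s j i b : i != j -> word s j 1 (letter (s i) b).
Proof.
by move=> ij; rewrite -[letter _ _]mulg1; constructor => //; constructor.
Qed.

Lemma word_inv s j m g : word s j m g -> word s j m g^-1.
Proof.
elim=> [|i b {}m {}g ij _ IH]; first by rewrite invg1; constructor.
rewrite invgM -addn1; apply: word_mul IH _.
have -> : (letter (s i) b)^-1 = letter (s i) (~~ b).
  by case: b; rewrite /letter ?invgK.
exact: word_letter.
Qed.

Lemma near_mulr s j m g x :
  word s j m g -> near m (upd s j x) (upd s j (x * g)).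
Proof.
move=> gw; elim: gw x => [|i b {}m {}g ij _ IH] x.
  by exists [::] => //=; rewrite mulg1.
have [w sw wE] := IH (x * letter (s i) b).
exists ((exist _ (i, j) ij, b, false) :: w) => //.
by rewrite run_cons_upd wE mulgA.
Qed.

Lemma near_mull s j m g x :
  word s j m g -> near m (upd s j x) (upd s j (g * x)).
Proof.
move=> gw; elim: gw x => [|i b {}m {}g ij _ IH] x.
  by exists [::] => //=; rewrite mul1g.
rewrite -addn1 -mulgA; apply: near_trans (IH x) _.
exists [:: (exist _ (i, j) ij, b, true)] => //.
by rewrite run_cons_upd.
Qed.

Lemma run_nseq s i j (nij : i != j) r :
  run (@apply_move G n) (nseq r (exist _ (i, j) nij, false, false)) s =
  upd s j (s j * s i ^+ r).
Proof.
suff H x : run (@apply_move G n) (nseq r (exist _ (i, j) nij, false, false))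
    (upd s j x) = upd s j (x * s i ^+ r) by rewrite -H upd_id.
elim: r x => [|r IH] x; first by rewrite mulg1.
by rewrite run_cons_upd IH expgS mulgA.
Qed.

(** Induction along the subgroup generated by the entries; the case
    [x * y^-1] covers products and inverses at once. *)
Lemma generating_ind s (P : G -> Prop) : s \in @generating_tuple G n ->
  P 1 -> (forall x y, P x -> P y -> P (x * y^-1)) -> (forall i, P (s i)) ->
  forall g, P g.
Proof.
rewrite inE /generating_tuple /= => sG P1 PM Ps g.
have : generated (range s) g by rewrite sG.
apply: smallest_sub; last by move=> _ [i _ <-]; exact: Ps.
by split; [rewrite inE|move=> x y; rewrite !inE; exact: PM].
Qed.

End Words.

(** Choose one index in each nonempty fibre of [tau]: at least two indices are
    not chosen, and each of them shares its fibre with a chosen one. *)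
Lemma pigeonhole (T : finType) n (tau : 'I_n -> T) : #|T|.+2 <= n ->
  exists j1 j2 i1 i2, [/\ j1 != j2, i1 != j1 /\ i1 != j2, i2 != j1 /\ i2 != j2,
    tau j1 = tau i1 & tau j2 = tau i2].
Proof.
move=> nT.
pose rho q := [pick i | tau i == q].
pose J := [set j | rho (tau j) != Some j]%SET.
have sJ : (1 < #|J|)%N.
  have : (#|~: J|%SET <= #|T|)%N.
    rewrite -(card_in_imset (f := tau)) ?max_card // => i i'.
    by rewrite !inE !negbK => /eqP ei /eqP ei' e; move: ei; rewrite e ei' => -[].
  have := cardsC J; rewrite card_ord; lia.
have rhoJ j : j \in J -> exists i, [/\ i \notin J, i != j & tau j = tau i].
  rewrite inE; case rE : (rho (tau j)) => [i|]; last first.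
    by move: rE; rewrite /rho; case: pickP => // /(_ j); rewrite eqxx.
  have ti : tau i = tau j.
    by move: rE; rewrite /rho; case: pickP => // ? /eqP ? [<-].
  by move=> ij; exists i; split=> //; rewrite inE negbK ti rE.
have /card_gt1P[j1 [j2 [j1J j2J j12]]] := sJ.
have [i1 [i1J i1j1 t1]] := rhoJ _ j1J; have [i2 [i2J i2j2 t2]] := rhoJ _ j2J.
exists j1, j2, i1, i2; split=> //; split=> //.
  by apply: contraNneq i1J => ->.
by apply: contraNneq i2J => ->.
Qed.

(** * The action on the cosets of a finite index subgroup *)

Section Cosets.
Variables (G : groupType) (Q : finType) (H : set G) (c : G -> Q).
Hypothesis Hgrp : subgroup H.
Hypothesis cP : forall x y : G, c x = c y <-> H (x^-1 * y)%g.
Local Open Scope group_scope.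

Lemma subgroup1 : H 1.
Proof. by case: Hgrp; rewrite inE. Qed.

Lemma subgroupMV x y : H x -> H y -> H (x * y^-1).
Proof. by case: Hgrp => _ /(_ x y); rewrite !inE. Qed.

Lemma subgroupV x : H x -> H x^-1.
Proof. by rewrite -[x^-1]mul1g; apply: subgroupMV; exact: subgroup1. Qed.

Lemma subgroupM x y : H x -> H y -> H (x * y).
Proof. by move=> Hx Hy; rewrite -[y]invgK; apply/subgroupMV/subgroupV. Qed.

Lemma coset_mull g x y : c x = c y -> c (g * x) = c (g * y).
Proof. by rewrite !cP invgM -mulgA mulKg. Qed.

Lemma coset_mulr x h : H h -> c (x * h) = c x.
Proof. by move=> Hh; apply/esym/cP; rewrite mulKg. Qed.

Definition trivial_on_cosets g := forall x, c (g * x) = c x.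

Lemma trivial_on_cosets_sub g : trivial_on_cosets g -> H g.
Proof. by move=> /(_ 1) /esym /cP; rewrite mulg1 invg1 mul1g. Qed.

Lemma trivial_on_cosets_conj g u : trivial_on_cosets g -> H (u^-1 * g * u).
Proof. by move=> /(_ u) /esym /cP; rewrite mulgA. Qed.

Definition coset_repr (q : Q) : G := xget 1 [set x | c x = q].

Lemma coset_reprK x : c (coset_repr (c x)) = c x.
Proof. by apply: (@xgetPex _ 1 [set y | c y = c x]); exists x. Qed.

Definition coset_action (g : G) : {ffun Q -> Q} :=
  [ffun q => c (g * coset_repr q)].

(** Elements inducing the same permutation of the cosets differ by an element of
    the normal core of [H]; this is what the pigeonhole principle is applied
    to. *)
Lemma coset_action_trivial g g' :
  coset_action g = coset_action g' -> trivial_on_cosets (g * g'^-1).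
Proof.
move=> /ffunP gg x; have := gg (c (g'^-1 * x)); rewrite !ffunE.
have cr a : c (a * coset_repr (c (g'^-1 * x))) = c (a * (g'^-1 * x)).
  by apply: coset_mull; exact: coset_reprK.
by rewrite !cr mulVKg mulgA.
Qed.

(** The entry [s j] acts trivially on the cosets, so the other entries already
    act transitively.  A shortest path in the resulting graph on [Q] has fewer
    than [#|Q|] edges and spells a short word that avoids [s j]. *)
Lemma short_transversal n (s : {ffun 'I_n -> G}) j :
  s \in @generating_tuple G n -> trivial_on_cosets (s j) ->
  exists u : Q -> G,
    (forall q, exists2 m, m <= #|Q| & word s j m (u q)) /\
    (forall x, c (u (c x)) = c x).
Proof.
move=> sG sj.
pose e := [rel q q' | [exists ib : 'I_n * bool,
  (ib.1 != j) && (c (letter (s ib.1) ib.2 * coset_repr q) == q')]].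
have eP i b x : i != j -> e (c x) (c (letter (s i) b * x)).
  move=> ij; apply/existsP; exists (i, b); rewrite ij /=; apply/eqP.
  by apply: coset_mull; exact: coset_reprK.
(* Asking for both g and its inverse makes this property of g stable under
   [x * y^-1], without a proof that the graph is symmetric. *)
have conn g : forall x, connect e (c x) (c (g * x)) /\
                        connect e (c x) (c (g^-1 * x)).
  move: g; apply: (generating_ind sG) => [x|g g' Pg Pg' x|i x].
  - by rewrite invg1 mul1g; split.
  - rewrite invgM invgK -!mulgA; split.
      by apply: connect_trans (Pg' x).2 (Pg _).1.
    by apply: connect_trans (Pg x).2 (Pg' _).1.
  have [->|ij] := eqVneq i j.
    split; first by rewrite sj.
    by rewrite -[in X in connect e X _](mulVKg (s j) x) sj.
  by split; apply: connect1; [exact: (eP i false)|exact: (eP i true)].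
have walk p m a : word s j m a -> path e (c a) p ->
    exists2 a', word s j (m + size p) a' & c a' = last (c a) p.
  elim: p m a => [|q p IH] m a wa /=; first by exists a; rewrite ?addn0.
  case/andP=> /existsP[[i b] /= /andP[ij /eqP qE]] pp.
  have wa' := word_cons b ij wa.
  have cq : c (letter (s i) b * a) = q.
    by rewrite -qE; apply: coset_mull; rewrite coset_reprK.
  rewrite -cq in pp *; have [a' wa'' ca'] := IH _ _ wa' pp.
  by exists a' => //; rewrite addnS -addSn.
have short q : exists a, (exists2 m, m <= #|Q| & word s j m a) /\
    c a = c (coset_repr q).
  have [+ _] := conn (coset_repr q) 1; rewrite mulg1 => /connectP[p].
  move=> /shortenP[p' pp' up' _] qE.
  have [a wa ca] := walk p' 0 1 (word_nil s j) pp'.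
  exists a; split; last by rewrite ca qE.
  exists (size p'); last by [].
  have : size (c 1 :: p') <= #|Q| by rewrite -(card_uniqP up') max_card.
  exact: ltnW.
have [u uP] := choice short.
exists u; split=> [q|x]; first exact: (uP q).1.
by rewrite (uP (c x)).2 coset_reprK.
Qed.

Variable f : G -> int.
Hypothesis fM : {in H &, forall x y, f (x * y) = (f x + f y)%R}.

Lemma hom1 : f 1 = 0%R.
Proof.
have H1 := subgroup1; have := fM (mem_set H1) (mem_set H1).
by rewrite mulg1; lia.
Qed.

Lemma homM x y : H x -> H y -> f (x * y) = (f x + f y)%R.
Proof. by move=> Hx Hy; apply: fM; apply: mem_set. Qed.

Lemma homMV x y : H x -> H y -> f (x * y^-1) = (f x - f y)%R.
Proof.
move=> Hx Hy; have := homM (subgroupMV Hx Hy) Hy.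
by rewrite mulgVK; lia.
Qed.

Lemma homX x r : H x -> H (x ^+ r) /\ f (x ^+ r) = (f x *+ r)%R.
Proof.
move=> Hx; elim: r => [|r [Hr fr]].
  by rewrite mulr0n hom1; split=> //; exact: subgroup1.
by rewrite expgS homM // fr mulrS; split=> //; exact: subgroupM.
Qed.

(** Schreier's argument.  With the transversal [U], the expression
    [f ((U (g * x))^-1 * (g * U x))] is a cocycle in [g], so if it vanished on
    all entries of the tuple it would vanish on [G].  On [H] and at the trivial
    coset it equals [f], which is not zero.  So it is nonzero for some entry
    [s i] and some [x].  If [i != j], the argument of [f] is a short word by
    which [s j] may be multiplied; if [i = j], it is a conjugate of [s j] by
    the short word [U x], because [s j] fixes the coset of [x]. *)
Lemma near_nonzero n (s : {ffun 'I_n -> G}) j :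
  (exists2 h, H h & f h <> 0%R) ->
  s \in @generating_tuple G n -> trivial_on_cosets (s j) ->
  exists y, [/\ near (#|Q| + #|Q|).+1 s (upd s j y), H y & f y <> 0%R].
Proof.
move=> [h Hh fh] sG sj; have Hsj := trivial_on_cosets_sub sj.
have [fsj|fsj] := eqVneq (f (s j)) 0%R; last first.
  exists (s j); split=> //; last exact/eqP.
  by rewrite upd_id; exists [::].
have [u [uw uc]] := short_transversal sG sj.
pose U x := u (c x).
have HU g x : H ((U (g * x))^-1 * (g * U x)).
  by apply/cP; rewrite uc; apply: coset_mull; rewrite uc.
apply: contrapT => nogood.
have cocycle g : forall x, f ((U (g * x))^-1 * (g * U x)) = 0%R.
  move: g; apply: (generating_ind sG) => [x|g g' Pg Pg' x|i x].
  - by rewrite !mul1g mulVg hom1.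
  - have -> : (U (g * g'^-1 * x))^-1 * (g * g'^-1 * U x) =
        ((U (g * (g'^-1 * x)))^-1 * (g * U (g'^-1 * x))) *
        ((U (g' * (g'^-1 * x)))^-1 * (g' * U (g'^-1 * x)))^-1.
      by rewrite mulVKg !invgM invgK !mulgA mulgK.
    by rewrite homMV // Pg Pg' subrr.
  apply: contrapT => fz; apply: nogood.
  have [m mQ wm] := uw (c (s i * x)); have [m' mQ' wm'] := uw (c x).
  have [ij|ij] := eqVneq i j.
    have UE : U (s i * x) = U x by rewrite /U ij sj.
    rewrite UE ij in fz; exists ((U x)^-1 * (s j * U x)); split=> //.
      have right := near_mulr (s j) wm'; rewrite upd_id in right.
      have left := near_mull (s j * U x) (word_inv wm').
      apply: near_leq (near_trans right left).
      by rewrite ltnW // ltnS leq_add.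
    by rewrite mulgA; exact: trivial_on_cosets_conj.
  have z := word_mul (word_inv wm) (word_mul (word_letter s false ij) wm').
  exists (s j * ((U (s i * x))^-1 * (s i * U x))); split.
  - have right := near_mulr (s j) z; rewrite upd_id in right.
    by apply: near_leq right; rewrite add1n addnS ltnS leq_add.
  - exact: subgroupM.
  by rewrite homM // fsj add0r.
apply: fh; have := cocycle h 1.
have -> : U (h * 1) = U 1 by rewrite /U mulg1 -[h]mul1g coset_mulr.
have HU1 : H (U 1) by have := uc 1 => /esym /cP; rewrite invg1 mul1g.
have HU1V := subgroupV HU1.
rewrite mulgA homM ?homM //; last exact: subgroupM.
by rewrite -[(U 1)^-1]mul1g homMV ?hom1 //; [lia|exact: subgroup1].
Qed.

(** The pigeonhole principle gives two entries that one move each puts into the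
    normal core of [H]; then [near_nonzero] acts on the first and leaves the
    second alone.  The order of the pair [p] is chosen last, so that the shear
    by the entry with the larger value of [f] can be used. *)
Lemma near_shear_pair n (s : {ffun 'I_n -> G}) :
  (exists2 h, H h & f h <> 0%R) ->
  #|{ffun Q -> Q}|.+2 <= n -> s \in @generating_tuple G n ->
  exists (p : {p : 'I_n * 'I_n | p.1 != p.2}) t,
    [/\ near (#|Q| + #|Q|).+3 s t, H (t (val p).1), H (t (val p).2),
        f (t (val p).1) <> 0%R &
        (`|f (t (val p).2)| <= `|f (t (val p).1)|)%R].
Proof.
move=> fnz nQ sG.
have [j1 [j2 [i1 [i2 [j12 [i1j1 i1j2] [i2j1 i2j2] t1 t2]]]]] :=
  pigeonhole (fun i => coset_action (s i)) nQ.
pose s1 := upd s j1 (s j1 * (s i1)^-1).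
pose s2 := upd s1 j2 (s j2 * (s i2)^-1).
have near1 : near 1 s s1.
  by rewrite -{1}(upd_id s j1); apply: near_mulr (word_letter s true i1j1).
have near2 : near 1 s1 s2.
  have s1E i : i != j1 -> s1 i = s i by exact: upd_neq.
  rewrite -{1}(upd_id s1 j2) s1E 1?eq_sym // /s2 -(s1E i2) //.
  exact: near_mulr (word_letter s1 true i2j2).
have nears2 := near_trans near1 near2.
have s2j1 : trivial_on_cosets (s2 j1).
  by rewrite upd_neq // upd_eq; exact: coset_action_trivial.
have s2j2 : trivial_on_cosets (s2 j2).
  by rewrite upd_eq; exact: coset_action_trivial.
have [y [neary Hy fy]] := near_nonzero fnz (near_generating nears2 sG) s2j1.
have j21 : j2 != j1 by rewrite eq_sym.
have tj2 : H (upd s2 j1 y j2).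
  by rewrite upd_neq //; exact: trivial_on_cosets_sub.
have near3 := near_trans nears2 neary.
have [le|lt] := lerP `|f (upd s2 j1 y j2)| `|f (upd s2 j1 y j1)|.
  by exists (exist _ (j1, j2) j12), (upd s2 j1 y); split; rewrite //= upd_eq.
exists (exist _ (j2, j1) j21), (upd s2 j1 y); split; rewrite //= ?upd_eq //.
  by move=> f0; move: lt; rewrite f0 normr0 normr_lt0.
by move: lt; rewrite upd_eq; exact: ltW.
Qed.

End Cosets.

Lemma finite_index_cosets (G : groupType) (H : set G) :
  subgroup H -> finite_index H ->
  exists (Q : finType) (c : G -> Q), forall x y, c x = c y <-> H (x^-1 * y)%g.
Proof.
move=> Hgrp /finite_fsetP[X XE].
have inX x : left_coset H x \in X.
  have : [set` X]%classic (left_coset H x) by rewrite -XE; exists x.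
  by [].
exists X, (fun x => [` inX x]%fset) => x y; split=> [|Hxy].
  move=> /(congr1 val) /= xy.
  have : left_coset H y y by exists 1%g; [exact: subgroup1|rewrite mulg1].
  by rewrite -xy => -[h Hh <-]; rewrite mulKg.
apply: val_inj => /=; apply/seteqP; split=> _ [h Hh <-].
  exists ((x^-1 * y)^-1 * h)%g; last first.
    by rewrite invgM invgK !mulgA mulgV mul1g.
  by apply: (subgroupM Hgrp) Hh; exact: subgroupV.
by exists (x^-1 * y * h)%g; [exact: (subgroupM Hgrp)|rewrite !mulgA mulgV mul1g].
Qed.

Lemma generating_tuple_exists (G : groupType) : finitely_generated G ->
  exists N, forall n, N <= n -> exists s, s \in @generating_tuple G n.
Proof.
move=> [A /finite_fsetP[X ->] AG]; exists #|` X| => n Xn.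
exists [ffun i : 'I_n => nth 1%g X i]; rewrite inE /generating_tuple /=.
apply/seteqP; split=> // x _; have : generated [set` X]%classic x by rewrite AG.
apply: smallest_sub; first exact: subgroup_generated.
move=> a /= aX; apply: sub_gen_smallest.
have ai : index a X < n by apply: leq_trans Xn; rewrite index_mem.
by exists (Ordinal ai) => //; rewrite ffunE nth_index.
Qed.

(** * Shears and the conclusion *)

(** The intervals of radius [|x|] around the multiples of [3x] are disjoint; with
    [2x] instead they would share endpoints. *)
Lemma shear_recover (x y y' : int) r r' :
  (x != 0 -> `|y| <= `|x| -> `|y'| <= `|x| ->
   y + x *+ (3 * r) = y' + x *+ (3 * r') -> r = r')%R.
Proof.
rewrite -(mulr_natr x (3 * r)) -(mulr_natr x (3 * r')) !natrM => x0 yx yx' e.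
have dxE : (x * (3 * (r%:R - r'%:R)) = y' - y)%R.
  by rewrite !mulrBr; move: e; move: (x * _)%R (x * _)%R => u u'; lia.
have dx : (`|x| * `|3 * (r%:R - r'%:R)| <= `|x| * 2 :> int)%R.
  rewrite -normrM dxE; apply: le_trans (ler_normB _ _) _.
  by rewrite mulr_natr mulr2n lerD.
by move: dx; rewrite ler_pM2l ?normr_gt0 //; lia.
Qed.

Theorem theorem1p3 (R : realType) (G : groupType) :
  finitely_generated G -> Z_large G ->
  exists N : nat, forall n : nat, (N <= n)%N ->
    non_amenable R (product_replacement_graph G n).
Proof.
move=> fg [H [Hgrp Hfin [f fM fsurj]]].
have [Q [c cP]] := finite_index_cosets Hgrp Hfin.
have fnz : exists2 h, H h & f h <> 0%R.
  by have [h Hh fh] := fsurj 1%R I; exists h; rewrite ?fh.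
have [N NP] := generating_tuple_exists fg.
(* The first bound makes the graph nonempty, the second is the one of the
   pigeonhole principle for the permutations of the cosets. *)
exists (maxn N #|{ffun Q -> Q}|.+2) => n; rewrite geq_max => /andP[Nn Qn].
pose L := (#|Q| + #|Q|).+3.
pose pair := {p : 'I_n * 'I_n | p.1 != p.2}.
pose good (s : {ffun 'I_n -> G}) (p : pair) :=
  [/\ H (s (val p).1), H (s (val p).2), f (s (val p).1) <> 0%R &
      (`|f (s (val p).2)| <= `|f (s (val p).1)|)%R].
(* A piece records the word that leads to a shearable pair, and the pair. *)
pose piece : finType := (L.-bseq (move n) * pair)%type.
have /choice[a aP] (v : @generating_tuple G n) : exists wp : piece,
    good (run (@apply_move G n) wp.1 (val v)) wp.2.
  have [p [t [[w wL wt] ? ? ? ?]]] := near_shear_pair Hgrp cP fM fnz Qn (valP v).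
  by exists (Bseq wL, p) => /=; rewrite wt.
pose W (r : 'I_#|piece|.+1) (wp : piece) : seq (move n) :=
  wp.1 ++ nseq (3 * r) (wp.2, false, false).
have val_run w (v : @generating_tuple G n) :
    val (run (@vertex_move G n) w v) = run (@apply_move G n) w (val v).
  by elim: w v => //= m w IH v; rewrite IH.
have WL r wp : size (W r wp) <= L + 3 * #|piece|.
  rewrite size_cat size_nseq leq_add ?size_bseq // leq_mul2l /=.
  by rewrite -ltnS ltn_ord.
have vm_inj m : injective (@vertex_move G n m).
  by move=> v v' /(congr1 val) /(can_inj (apply_moveK m)) /val_inj.
(* Each shear leaves the i-th entry unchanged, so the two images share x, and
   their j-th entries determine the number of shears. *)
have Wdisj v v' r r' : a v = a v' ->
    run (@vertex_move G n) (W r (a v)) v =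
    run (@vertex_move G n) (W r' (a v')) v' -> r = r'.
  move=> av /(congr1 val); rewrite !val_run !run_cat.
  have := aP v; have := aP v'; rewrite -av; case: (a v) => w [[i j] ij] /=.
  set t := run _ w (val v); set t' := run _ w (val v').
  case=> /= Hi' Hj' _ ji' [/= Hi Hj fi ji]; rewrite !run_nseq => /ffunP tt'.
  have ti : t i = t' i by have := tt' i; rewrite !upd_neq.
  have := tt' j; rewrite !upd_eq -ti => /(congr1 f).
  have [Hr fr] := homX Hgrp fM (3 * r) Hi.
  have [Hr' fr'] := homX Hgrp fM (3 * r') Hi.
  rewrite !(homM fM) // fr fr' => /shear_recover e; apply: ord_inj; apply: e => //.
    exact/eqP.
  by rewrite ti.
have [s0 s0G] := NP n Nn.
apply: (non_amenable_isoperimetric R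
  (C := #|piece| * (#|piece|.+1 * (L + 3 * #|piece|)))).
  by split; exact: (Sub s0 s0G).
move=> X; have := paradoxical_bound vm_inj (ltnSn _) WL Wdisj (fset_uniq X).
by apply => m; exact: leak_boundary.
Qed.
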